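(* For every graph $G$ with no isolated vertices, there is a graph $H$ and some $sec$-partition $\pi$ of $H$ such that $SCG(H,\pi)\cong G$.
   Context: Graphs are finite and simple with a non-empty vertex set. A set $D\subseteq V(H)$ is a dominating set of a graph $H$ if every vertex of $V(H)\setminus D$ is adjacent to at least one vertex of $D$. A secure dominating set $S$ of $H$ is a dominating set such that each vertex $u\in V(H)\setminus S$ is adjacent to some vertex $v\in S$ for which $(S\setminus\{v\})\cup\{u\}$ is a dominating set. Two disjoint vertex sets $V_1,V_2\subseteq V(H)$ form a secure coalition if neither $V_1$ nor $V_2$ is a secure dominating set but $V_1\cup V_2$ is a secure dominating set. A secure coalition partition ($sec$-partition) of a graph $H$ is a partition $\pi=\{V_1,\dots,V_k\}$ of $V(H)$ (into non-empty sets) such that every $V_i$ either is a secure dominating set consisting of a single vertex of degree $|V(H)|-1$, or is not a secure dominating set but forms a secure coalition with another set $V_j\in\pi$. Given a $sec$-partition $\pi=\{V_1,\dots,V_k\}$ of $H$, the secure coalition graph $SCG(H,\pi)$ is the graph with vertex set $\{V_1,\dots,V_k\}$ in which $V_i$ and $V_j$ are adjacent if and only if $V_i$ and $V_j$ form a secure coalition in $H$. *)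

(* Defs.v *)
From mathcomp Require Import all_boot.

Set Implicit Arguments.
Unset Strict Implicit.
Unset Printing Implicit Defensive.

Record sgraph := SGraph {
  vertex :> finType;
  adj : rel vertex;
  adj_sym : symmetric adj;
  adj_irr : irreflexive adj;
  vertex_gt0 : 0 < #|vertex|
}.

Definition graph_iso (G H : sgraph) : Prop :=
  exists2 f : G -> H, bijective f & forall x y, adj (f x) (f y) = adj x y.

Section Graph.
Variable H : sgraph.
Implicit Types (u v : H) (D S V W : {set H}) (pi : {set {set H}}).

Definition degree v : nat := #|[set u | adj v u]|.

Definition isolated v : bool := degree v == 0.

Definition dominating D : bool :=
  [forall u in ~: D, [exists v in D, adj u v]].

Definition secure_dominating S : bool :=
  dominating S &&
  [forall u in ~: S, [exists v in S, adj u v && dominating (u |: (S :\ v))]].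

Definition secure_coalition V W : bool :=
  [&& [disjoint V & W], ~~ secure_dominating V, ~~ secure_dominating W
    & secure_dominating (V :|: W)].

Definition full_singleton V : bool :=
  [exists v, (V == [set v]) && (degree v == #|H|.-1)].

(* [partition] already requires the blocks to be non-empty. *)
Definition sec_partition pi : bool :=
  partition pi [set: H] &&
  [forall V in pi,
     (secure_dominating V && full_singleton V) ||
     (~~ secure_dominating V &&
      [exists W in pi, (W != V) && secure_coalition V W])].

Lemma secure_coalition_sym : symmetric secure_coalition.
Proof.
by move=> V W; rewrite /secure_coalition disjoint_sym setUC (andbCA (~~ _)).
Qed.

Lemma secure_coalition_irr : irreflexive secure_coalition.
Proof.
by move=> V; rewrite /secure_coalition setUid; case: secure_dominating;
  rewrite /= ?andbF.
Qed.

Section SCG.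
Variables (pi : {set {set H}}) (pi_sec : sec_partition pi).

Definition block : finType := {V : {set H} | V \in pi}.

Definition scg_adj : rel block :=
  fun b c => secure_coalition (val b) (val c).

Lemma scg_adj_sym : symmetric scg_adj.
Proof. by move=> b c; apply: secure_coalition_sym. Qed.

Lemma scg_adj_irr : irreflexive scg_adj.
Proof. by move=> b; apply: secure_coalition_irr. Qed.

Lemma block_gt0 : 0 < #|block|.
Proof.
have /card_gt0P[x _] := vertex_gt0 H.
have /andP[/and3P[/eqP covT _ _] _] := pi_sec.
have : x \in cover pi by rewrite covT inE.
case/bigcupP=> V Vpi _.
by apply/card_gt0P; exists (exist _ V Vpi).
Qed.

Definition SCG : sgraph := SGraph scg_adj_sym scg_adj_irr block_gt0.

End SCG.
End Graph.

(* Main.v *)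
Require Import Defs.
From mathcomp Require Import all_boot.

(** The host graph H has two kinds of vertices.  Its core is a clique with two
    copies of every vertex of G; besides, there is one witness for every ordered
    pair (i, j) of non-adjacent vertices of G, the pairs (i, i) included.  The
    witness of (i, j) is adjacent to exactly the core vertices that are copies
    of neither i nor j, and witnesses are pairwise non-adjacent.  Colour a core
    vertex by the vertex of G it copies, and the witness of (i, j) by some
    neighbour of i: it exists because i is not isolated, and it differs from
    both i and j because i is adjacent to neither.  The partition is that of
    the colour classes.

    If i and j are not adjacent in G, the classes of i and j contain neither the
    witness of (i, j) nor any of its neighbours, so that their union does not
    dominate H ([disjoint_closed_nbhd]).  Taking i = j, no single class
    dominates H.

    If i and j are adjacent in G, one copy of each suffices to dominate H: a
    witness missed by both would belong to the non-adjacent pair (i, j) or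
    (j, i) ([core_pair_dominating]).  As the core has two copies of everything,
    the union of the two classes dominates H even after the removal of any one
    vertex, hence every swap preserves domination and the union is secure
    ([robust_secure_dominating]).  So the classes of i and j form a secure
    coalition exactly when i and j are adjacent, and each class has a partner
    since G has no isolated vertex. *)

Set Implicit Arguments.
Unset Strict Implicit.
Unset Printing Implicit Defensive.

Lemma dominatingP (H : sgraph) (D : {set H}) :
  reflect (forall u, u \notin D -> exists2 v, v \in D & adj u v)
          (dominating D).
Proof.
apply: (iffP forall_inP) => [domD u uD | domD u].
  by have /exists_inP := domD u (etrans (in_setC _ _) uD).
by rewrite inE => /domD ?; apply/exists_inP.
Qed.

Lemma dominatingS (H : sgraph) (D E : {set H}) :
  D \subset E -> dominating D -> dominating E.
Proof.
move=> /subsetP sDE /dominatingP domD; apply/dominatingP => u uE.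
have [|v vD uv] := domD u; first by apply: contra uE; apply: sDE.
by exists v; first exact: sDE.
Qed.

(** Domination with one vertex to spare is secure: the incoming vertex of a swap
    can only help, and [S] itself dominates, so every outside vertex has a
    neighbour to be swapped with. *)
Lemma robust_secure_dominating (H : sgraph) (S : {set H}) :
  dominating S -> (forall v, dominating (S :\ v)) -> secure_dominating S.
Proof.
move=> domS domSv; rewrite /secure_dominating domS /=.
apply/forall_inP => u; rewrite inE => uS.
have [v vS uv] := dominatingP _ domS u uS.
apply/exists_inP; exists v => //; rewrite uv /=.
exact: dominatingS (subsetUr _ _) (domSv v).
Qed.

Lemma graph_iso_sym (G H : sgraph) : graph_iso G H -> graph_iso H G.
Proof.
case=> f [g fK gK] f_adj; exists g; first by exists f.
by move=> x y; rewrite -f_adj !gK.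
Qed.

Section Host.
Variable G : sgraph.
Hypothesis hG : forall v : G, ~~ isolated v.

Lemma has_neighbour (i : G) : exists j, adj i j.
Proof.
have := hG i; rewrite /isolated /degree cards_eq0 => /set0Pn[j].
by rewrite inE => ij; exists j.
Qed.

Definition neighbour (i : G) : G := xchoose (has_neighbour i).

Lemma adj_neighbour i : adj i (neighbour i).
Proof. exact: xchooseP (has_neighbour i). Qed.

Definition nonedge : finType := {p : G * G | ~~ adj p.1 p.2}.

Definition host_vertex : finType := ((G * bool) + nonedge)%type.

Definition misses (p : nonedge) (k : G) : bool :=
  (k != (val p).1) && (k != (val p).2).

Definition host_adj : rel host_vertex := fun x y =>
  match x, y with
  | inl c, inl d => c != d
  | inl c, inr p | inr p, inl c => misses p c.1
  | inr _, inr _ => false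
  end.

Lemma host_adj_sym : symmetric host_adj.
Proof. by case=> [c|p] [d|q] //=; rewrite eq_sym. Qed.

Lemma host_adj_irr : irreflexive host_adj.
Proof. by case=> [c|p] //=; rewrite eqxx. Qed.

Lemma host_vertex_gt0 : 0 < #|host_vertex|.
Proof.
have /card_gt0P[i _] := vertex_gt0 G.
by apply/card_gt0P; exists (inl (i, true)).
Qed.

Definition host : sgraph := SGraph host_adj_sym host_adj_irr host_vertex_gt0.

Definition colour (x : host) : G :=
  match x with
  | inl c => c.1
  | inr p => neighbour (val p).1
  end.

Definition colour_class (i : G) : {set host} := [set x | colour x == i].

Definition colour_classes : {set {set host}} := [set colour_class i | i : G].

Lemma core_colour_class i b : (inl (i, b) : host) \in colour_class i.
Proof. by rewrite inE /=. Qed.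

Lemma colour_class_inj : injective colour_class.
Proof.
move=> i j eq_ij; have := core_colour_class i true.
by rewrite eq_ij inE => /eqP.
Qed.

Lemma partition_colour_classes : partition colour_classes [set: host].
Proof.
apply/and3P; split.
- rewrite eqEsubset subsetT; apply/subsetP => x _.
  apply/bigcupP; exists (colour_class (colour x)); first exact: imset_f.
  by rewrite inE.
- apply/trivIsetP => _ _ /imsetP[i _ ->] /imsetP[j _ ->].
  apply: contraR => /pred0Pn[x /=].
  by rewrite !inE => /andP[/eqP<- /eqP<-].
- apply/imsetP => -[i _ eq0].
  by have := core_colour_class i true; rewrite -eq0 inE.
Qed.

(** The obstruction to domination: all of the closed neighbourhood of the
    witness of (i, j) lies outside the classes of i and j. *)
Lemma disjoint_closed_nbhd i j :
  ~~ adj i j -> ~~ dominating (colour_class i :|: colour_class j).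
Proof.
move=> nij; pose p : nonedge := exist _ (i, j) nij.
have i_nb := adj_neighbour i.
apply/negP => /dominatingP/(_ (inr p))[|[c|q]] //=.
  rewrite !inE /= negb_or; apply/andP; split; apply/eqP => nb_eq.
    by rewrite nb_eq adj_irr in i_nb.
  by rewrite nb_eq (negbTE nij) in i_nb.
by rewrite !inE /= /misses /= => /orP[] /eqP->; rewrite eqxx ?andbF.
Qed.

Lemma colour_class_not_secure i : ~~ secure_dominating (colour_class i).
Proof.
have := @disjoint_closed_nbhd i i; rewrite adj_irr setUid => /(_ isT).
by apply: contra => /andP[].
Qed.

Lemma misses_edge p i j : adj i j -> misses p i || misses p j.
Proof.
case: p => -[k l] /= nkl ij; rewrite /misses /= -negb_or -negb_or -negb_and.
have neq_ij : i != j by apply: contraTneq ij => ->; rewrite adj_irr.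
apply/negP => /andP[/orP[] /eqP ei /orP[] /eqP ej]; move: ij neq_ij nkl.
- by rewrite ei ej eqxx.
- by rewrite ei ej => ->.
- by rewrite ei ej adj_sym => ->.
- by rewrite ei ej eqxx.
Qed.

(** Any copies of the two ends of an edge will do; the freedom in [b] and [c] is
    what survives the removal of a vertex. *)
Lemma core_pair_dominating i j b c (D : {set host}) : adj i j ->
  (inl (i, b) : host) \in D -> (inl (j, c) : host) \in D -> dominating D.
Proof.
move=> ij iD jD; apply/dominatingP => -[d|p] xD.
  exists (inl (i, b)) => //=.
  by apply: contraNneq xD => ->.
have /orP[mi|mj] := misses_edge p ij; first by exists (inl (i, b)).
by exists (inl (j, c)).
Qed.

Lemma edge_secure i j :
  adj i j -> secure_dominating (colour_class i :|: colour_class j).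
Proof.
move=> ij; apply: robust_secure_dominating => [|v].
  by apply: (@core_pair_dominating i j true true); rewrite ?inE ?eqxx ?orbT.
have copy k : exists b, (inl (k, b) : host) != v.
  have [<-|] := eqVneq (inl (k, true) : host) v; last by exists true.
  by exists false; apply/eqP => -[].
have [[b bv] [c cv]] := (copy i, copy j).
apply: (@core_pair_dominating i j b c) => //.
  by rewrite in_setD1 bv inE core_colour_class.
by rewrite in_setD1 cv inE core_colour_class orbT.
Qed.

Lemma secure_coalition_colour_class i j :
  secure_coalition (colour_class i) (colour_class j) = adj i j.
Proof.
apply/idP/idP => [/and4P[_ _ _ /andP[dom _]] | ij].
  by apply: contraLR dom; apply: disjoint_closed_nbhd.
rewrite /secure_coalition !colour_class_not_secure edge_secure // !andbT.
have /and3P[_ /trivIsetP disj _] := partition_colour_classes.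
apply: disj; rewrite ?imset_f // (inj_eq colour_class_inj).
by apply: contraTneq ij => ->; rewrite adj_irr.
Qed.

Lemma sec_partition_colour_classes : sec_partition colour_classes.
Proof.
rewrite /sec_partition partition_colour_classes /=.
apply/forall_inP => _ /imsetP[i _ ->]; apply/orP; right.
rewrite colour_class_not_secure; apply/exists_inP.
have i_nb := adj_neighbour i.
exists (colour_class (neighbour i)); first exact: imset_f.
rewrite secure_coalition_colour_class i_nb andbT (inj_eq colour_class_inj).
by apply: contraTneq i_nb => ->; rewrite adj_irr.
Qed.

Lemma SCG_colour_classes_iso : graph_iso (SCG sec_partition_colour_classes) G.
Proof.
apply: graph_iso_sym.
have class_in i : colour_class i \in colour_classes by exact: imset_f.
pose f i : SCG sec_partition_colour_classes :=
  exist (fun V => V \in colour_classes) _ (class_in i).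
exists f => [|i j]; last exact: secure_coalition_colour_class.
have class_of (b : SCG sec_partition_colour_classes) :
    exists i, colour_class i == val b.
  by have /imsetP[i _ ->] := valP b; exists i.
exists (fun b => xchoose (class_of b)) => [i|b].
  by apply: colour_class_inj; rewrite (eqP (xchooseP (class_of (f i)))).
exact/val_inj/eqP/(xchooseP (class_of b)).
Qed.

End Host.

Theorem theorem5p1 (G : sgraph) (hG : forall v : G, ~~ isolated v) :
  exists (H : sgraph) (pi : {set {set H}}) (hpi : sec_partition pi),
    graph_iso (SCG hpi) G.
Proof.
exists (host G), (colour_classes hG), (sec_partition_colour_classes hG).
exact: SCG_colour_classes_iso.
Qed.
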